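(* The function $\Delta$ satisfies $|\Delta(x)-\Delta(y)|\le 2|x-y|$ for all $x,y\in(0,1]$; in particular $\Delta$ is continuous on $(0,1]$. Furthermore, the function $\varepsilon\mapsto \Delta(\varepsilon)/\varepsilon^2$ is increasing on $(0,1]$, and hence $\lim_{\varepsilon\to0^+}\Delta(\varepsilon)/\varepsilon^2$ exists.
   Context: Let $\lambda$ denote Lebesgue measure on $\mathbb{R}$. A set $C\subseteq\mathbb{R}$ is symmetric if there is a number $c$ such that $c+x\in C$ if and only if $c-x\in C$. For a measurable $A\subseteq\mathbb{R}$ let $D(A):=\sup\{\lambda(C): C\subseteq A,\ C \text{ measurable and symmetric}\}$. For $0\le\varepsilon\le1$ let $\Delta(\varepsilon):=\inf\{D(A): A\subseteq[0,1) \text{ measurable},\ \lambda(A)=\varepsilon\}$ (equivalently, the supremum of $\delta$ such that every measurable subset of $[0,1)$ of measure $\varepsilon$ contains a symmetric subset of measure $\delta$). *)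

(* Defs.v *)
From HB Require Import structures.
From mathcomp Require Import all_boot all_order all_algebra.
From mathcomp Require Import all_classical all_reals all_analysis.
Set Implicit Arguments. Unset Strict Implicit. Unset Printing Implicit Defensive.
Import Order.TTheory GRing.Theory Num.Theory.
Import numFieldNormedType.Exports.
Local Open Scope classical_set_scope.
Local Open Scope ring_scope.

Definition leb {R : realType} := @completed_lebesgue_measure R.

(* The measurable space carrying the Lebesgue-measurable sets. *)
Definition LebT (R : realType) :=
  ltac:(let t := type of (@completed_lebesgue_measure R) in
        match t with set ?T -> _ => exact T end).

Definition symmetric {R : realType} (C : set R) : Prop :=
  exists c : R, forall x : R, C (c + x) <-> C (c - x).

Definition Dsym {R : realType} (A : set (LebT R)) : \bar R :=
  ereal_sup [set leb C | C in
    [set C : set (LebT R) | measurable C /\ symmetric (C : set R) /\ C `<=` A]].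

(* Delta(eps) = inf of D(A) over measurable A ⊆ [0,1) with λ(A) = eps.
   (The infimum is a real number in [0,1] whenever 0 <= eps <= 1; we take
   its real part with [fine].) *)
Definition Delta {R : realType} (eps : R) : R :=
  fine (ereal_inf [set Dsym A | A in
    [set A : set (LebT R) | measurable A /\ A `<=` (`[0, 1[ : set R)
                            /\ leb A = eps%:E]]).

(* Main.v *)
(* Since D(A) is the supremum over c of the measure of A ∩ (c - A), removing a
   set of measure m from A changes D(A) by at most 2m, which gives the
   Lipschitz bound.  For the monotonicity of Delta(e) / e^2, one removes from A
   a fine periodic set T whose residues modulo N = 3^k are the k powers
   3^0, ..., 3^(k-1).  With q = k / N, translation continuity of A makes T
   occupy the proportion q of each A ∩ (c - A), uniformly in c, while the Sidon
   property makes A ∩ T ∩ (c - T) of measure at most about 4 / N.  Hence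
   Delta((1 - q) e) <= (1 - 2q) Delta(e) + 4q / k.  Iterating this from y down
   to x takes about log(y / x) / q steps, so the errors add up to O(1 / k), and
   k tends to infinity. *)
Require Import Defs.
From HB Require Import structures.
From mathcomp Require Import all_boot all_order all_algebra.
From mathcomp Require Import all_classical all_reals all_analysis.
From mathcomp Require Import measurable_realfun ring lra zify.
Set Implicit Arguments. Unset Strict Implicit. Unset Printing Implicit Defensive.
Import Order.TTheory GRing.Theory Num.Theory.
Import numFieldNormedType.Exports.
Local Open Scope classical_set_scope.
Local Open Scope ring_scope.

(** * Real-valued Lebesgue measure on sets of reals *)

Definition leb_measurable {R : realType} (A : set R) : Prop :=
  measurable (A : set (LebT R)).
Definition leb_finite {R : realType} (A : set R) : Prop :=
  (leb (A : set (LebT R)) < +oo)%E.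
(* leb is an outer measure on all sets, so mu makes sense for any A; it is 0
   (junk) when A has infinite measure. *)
Definition mu {R : realType} (A : set R) : R := fine (leb (A : set (LebT R))).
Definition reflect_set {R : realType} (c : R) (A : set R) : set R :=
  [set x | A (c - x)].
Definition shift_set {R : realType} (h : R) (A : set R) : set R :=
  [set x | A (x + h)].

Lemma leb_mono {R : realType} (A B : set R) : A `<=` B ->
  (leb (A : set (LebT R)) <= leb (B : set (LebT R)))%E.
Proof. exact: (@le_outer_measure _ _ ((wlength idfun)^*)%mu). Qed.

Lemma leb_ge0 {R : realType} (A : set R) : (0 <= leb (A : set (LebT R)))%E.
Proof. exact: (@outer_measure_ge0 _ _ ((wlength idfun)^*)%mu). Qed.

Lemma leb_fin_num {R : realType} (A : set R) : leb_finite A ->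
  leb (A : set (LebT R)) = (mu A)%:E.
Proof. by move=> fA; rewrite fineK// ge0_fin_numE// leb_ge0. Qed.

Lemma mu_ge0 {R : realType} (A : set R) : 0 <= mu A.
Proof. by rewrite fine_ge0// leb_ge0. Qed.

Lemma leb_finiteS {R : realType} (A B : set R) : A `<=` B ->
  leb_finite B -> leb_finite A.
Proof. by move=> AB; apply: le_lt_trans; exact: leb_mono. Qed.

Lemma leb_finiteU {R : realType} (A B : set R) :
  leb_finite A -> leb_finite B -> leb_finite (A `|` B).
Proof.
move=> fA fB.
apply: le_lt_trans (@outer_measureU2 _ _ ((wlength idfun)^*)%mu A B) _.
exact: lte_add_pinfty.
Qed.

Lemma mu_mono {R : realType} (A B : set R) : leb_finite B -> A `<=` B ->
  mu A <= mu B.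
Proof.
move=> fB AB; rewrite -lee_fin -!leb_fin_num//; first exact: leb_mono.
exact: leb_finiteS AB fB.
Qed.

Lemma mu_subU {R : realType} (A B C : set R) : leb_finite B -> leb_finite C ->
  A `<=` B `|` C -> mu A <= mu B + mu C.
Proof.
move=> fB fC ABC; apply: (@le_trans _ _ (mu (B `|` C))).
  by apply: mu_mono => //; exact: leb_finiteU.
rewrite -lee_fin EFinD -!leb_fin_num//; last exact: leb_finiteU.
exact: (@outer_measureU2 _ _ ((wlength idfun)^*)%mu B C).
Qed.

Lemma mu_split {R : realType} (A B : set R) : leb_measurable B -> leb_finite A ->
  mu A = mu (A `&` B) + mu (A `\` B).
Proof.
move=> mB fA; apply/EFin_inj; rewrite EFinD -!leb_fin_num//.
- exact: mB.
- by apply: (leb_finiteS _ fA) => x [].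
- by apply: (leb_finiteS _ fA) => x [].
Qed.

Lemma leb_measurableI {R : realType} (A B : set R) :
  leb_measurable A -> leb_measurable B -> leb_measurable (A `&` B).
Proof. exact: measurableI. Qed.

Lemma leb_measurableU {R : realType} (A B : set R) :
  leb_measurable A -> leb_measurable B -> leb_measurable (A `|` B).
Proof. exact: measurableU. Qed.

Lemma leb_measurableD {R : realType} (A B : set R) :
  leb_measurable A -> leb_measurable B -> leb_measurable (A `\` B).
Proof. exact: measurableD. Qed.

Lemma borel_leb_measurable {R : realType} (A : set R) :
  measurable A -> leb_measurable A.
Proof. exact: sub_caratheodory. Qed.

Lemma open_leb_measurable {R : realType} (A : set R) : open A -> leb_measurable A.
Proof. by move=> oA; apply: borel_leb_measurable; exact: open_measurable. Qed.

Lemma mu_itvco {R : realType} (a b : R) : a <= b ->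
  leb_finite `[a, b[%classic /\ mu `[a, b[%classic = b - a.
Proof.
move=> ab.
have E : leb (`[a, b[%classic : set (LebT R)) = (b - a)%:E.
  transitivity (lebesgue_measure (`[a, b[%classic : set R)) => //.
  rewrite lebesgue_measure_itv/= lte_fin; move: ab.
  by rewrite le_eqVlt => /predU1P[->|->]; rewrite ?ltxx ?subrr.
by rewrite /leb_finite /mu E; split; rewrite ?ltry.
Qed.

(** * Invariance under reflections and translations *)

(** A cover of [A] by open intervals reflects to a cover by open intervals of the same lengths.
    Since reflection is an involution, this one inequality already yields equality, for arbitrary
    sets. *)
Lemma leb_reflect_le {R : realType} (c : R) (A : set R) :
  (leb (reflect_set c A : set (LebT R)) <= leb (A : set (LebT R)))%E.
Proof.
rewrite /leb /completed_lebesgue_measure/= /completed_lebesgue_stieltjes_measure.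
rewrite /completed_measure_extension !outer_measure_open_itv_cover.
apply: le_ereal_inf_tmp => _ [F [Fo AF] <-].
apply: ereal_inf_lbound; exists (fun k => reflect_set c (F k)); last first.
  apply: eq_eseriesr => k _; have [[a b] ->] := Fo k.
  rewrite (_ : reflect_set c _ = `]c - b, c - a[%classic); last first.
    apply/seteqP; split=> x; rewrite /reflect_set/= !in_itv/=; lra.
  rewrite !wlength_itv/= !lte_fin ltrD2l ltrN2 -!EFinB.
  by case: ifP => // _; congr EFin; ring.
split=> [k|x /AF [k _ Fk]]; last by exists k.
have [[a b] ->] := Fo k; exists (c - b, c - a) => //=.
apply/seteqP; split=> x; rewrite /reflect_set/= !in_itv/=; lra.
Qed.

Lemma reflect_setK {R : realType} (c : R) : involutive (reflect_set c).
Proof.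
by move=> A; apply/seteqP; split=> x; rewrite /reflect_set/= opprB addrC subrK.
Qed.

Lemma leb_reflect {R : realType} (c : R) (A : set R) :
  leb (reflect_set c A : set (LebT R)) = leb (A : set (LebT R)).
Proof.
apply/eqP; rewrite eq_le leb_reflect_le/= -{1}(reflect_setK c A).
exact: leb_reflect_le.
Qed.

Lemma shift_setE {R : realType} (h : R) (A : set R) :
  shift_set h A = reflect_set 0 (reflect_set h A).
Proof.
by apply/seteqP; split=> x; rewrite /shift_set /reflect_set/= sub0r opprK addrC.
Qed.

Lemma leb_shift {R : realType} (h : R) (A : set R) :
  leb (shift_set h A : set (LebT R)) = leb (A : set (LebT R)).
Proof. by rewrite shift_setE !leb_reflect. Qed.

(** Carathéodory's criterion, which is how the completed sigma-algebra is defined; it reduces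
    measurability of a reflected set to invariance of the outer measure. *)
Lemma leb_measurableP {R : realType} (A : set R) : leb_measurable A <->
  forall X : set R, leb (X : set (LebT R)) =
    (leb (X `&` A : set (LebT R)) + leb (X `&` ~` A : set (LebT R)))%E.
Proof. by split; apply. Qed.

Lemma leb_measurable_reflect {R : realType} (c : R) (A : set R) :
  leb_measurable A -> leb_measurable (reflect_set c A).
Proof.
move=> /leb_measurableP mA; apply/leb_measurableP => X.
have := mA (reflect_set c X); rewrite leb_reflect => ->.
have E (B : set R) : reflect_set c X `&` B = reflect_set c (X `&` reflect_set c B).
  by rewrite -[in LHS](reflect_setK c B).
by rewrite !E !leb_reflect.
Qed.

Lemma mu_reflect {R : realType} (c : R) (A : set R) : mu (reflect_set c A) = mu A.
Proof. by rewrite /mu leb_reflect. Qed.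

Lemma mu_shift {R : realType} (h : R) (A : set R) : mu (shift_set h A) = mu A.
Proof. by rewrite /mu leb_shift. Qed.

Lemma leb_finite_reflect {R : realType} (c : R) (A : set R) :
  leb_finite A -> leb_finite (reflect_set c A).
Proof. by rewrite /leb_finite leb_reflect. Qed.

Lemma leb_finite_shift {R : realType} (h : R) (A : set R) :
  leb_finite A -> leb_finite (shift_set h A).
Proof. by rewrite /leb_finite leb_shift. Qed.

Lemma leb_finite_unit {R : realType} (A : set R) : A `<=` `[0, 1[ -> leb_finite A.
Proof. by move=> A01; apply: (leb_finiteS A01); have [] := mu_itvco (@ler01 R). Qed.

Lemma mu_unit_le1 {R : realType} (A : set R) : A `<=` `[0, 1[ -> mu A <= 1.
Proof.
move=> A01; have [f01 m01] := mu_itvco (@ler01 R).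
by rewrite -[leRHS]subr0 -m01; exact: mu_mono.
Qed.

(** * The largest symmetric subset, as a supremum over reflections *)

Definition sym_mu {R : realType} (A : set R) : R := fine (Dsym (A : set (LebT R))).

Lemma Dsym_fin_num {R : realType} (A : set R) : A `<=` `[0, 1[ ->
  Dsym (A : set (LebT R)) = (sym_mu A)%:E.
Proof.
move=> A01; rewrite fineK// fin_numElt; apply/andP; split.
  apply: (@lt_le_trans _ _ 0%E); first exact: ltNy0.
  apply: (@le_trans _ _ (leb (set0 : set (LebT R)))); first exact: leb_ge0.
  apply: ereal_sup_ubound; exists set0 => //.
  by split; [exact: measurable0|split=> //; exists 0 => x].
apply: (@le_lt_trans _ _ (leb (A : set (LebT R)))); last exact: leb_finite_unit.
by apply: ge_ereal_sup => _ [C [_ [_ CA]] <-]; exact: leb_mono.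
Qed.

(** The intersection of [A] with [c - A] is itself a competitor: it is symmetric about [c / 2]. *)
Lemma reflect_le_sym_mu {R : realType} (A : set R) (c : R) :
  leb_measurable A -> A `<=` `[0, 1[ -> mu (A `&` reflect_set c A) <= sym_mu A.
Proof.
move=> mA A01; rewrite -lee_fin -Dsym_fin_num// -leb_fin_num; last first.
  by apply: (leb_finiteS _ (leb_finite_unit A01)) => x [].
apply: ereal_sup_ubound; exists (A `&` reflect_set c A) => //.
split; last split; last by move=> x [].
  by apply: leb_measurableI => //; exact: leb_measurable_reflect.
exists (c / 2) => x; rewrite /reflect_set/=.
have -> : c - (c / 2 + x) = c / 2 - x by lra.
have -> : c - (c / 2 - x) = c / 2 + x by lra.
by split=> -[].
Qed.

(** A subset of [A] symmetric about [c] lies in the intersection of [A] with [2c - A]. With the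
    previous bound, [sym_mu A] is thus the supremum of these intersections' measures. *)
Lemma sym_mu_le {R : realType} (A : set R) (z : R) : A `<=` `[0, 1[ ->
  (forall c, mu (A `&` reflect_set c A) <= z) -> sym_mu A <= z.
Proof.
move=> A01 Az; rewrite -lee_fin -Dsym_fin_num//.
apply: ge_ereal_sup => _ [C [_ [[c cC] CA]] <-].
have fA := leb_finite_unit A01.
rewrite leb_fin_num ?lee_fin; last exact: leb_finiteS CA fA.
apply: le_trans (Az (c + c)); apply: mu_mono.
  by apply: (leb_finiteS _ fA) => x [].
move=> x Cx; split; first exact: CA.
apply: CA; rewrite (_ : c + c - x = c - (x - c)); last by ring.
by apply: (cC _).1; rewrite addrC subrK.
Qed.

Lemma sym_mu_ge0 {R : realType} (A : set R) : leb_measurable A ->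
  A `<=` `[0, 1[ -> 0 <= sym_mu A.
Proof. by move=> mA A01; apply: le_trans (reflect_le_sym_mu 0 mA A01); exact: mu_ge0. Qed.

Lemma sym_mu_mono {R : realType} (A B : set R) : leb_measurable A ->
  A `<=` `[0, 1[ -> B `<=` A -> sym_mu B <= sym_mu A.
Proof.
move=> mA A01 BA; apply: sym_mu_le => [|c]; first exact: subset_trans A01.
apply: le_trans (reflect_le_sym_mu c mA A01); apply: mu_mono.
  by apply: (leb_finiteS _ (leb_finite_unit A01)) => x [].
by move=> x [Bx By]; split; apply: BA.
Qed.

(** A point lost when passing from [A] to [B] lies in [A \ B] or in its reflection, two sets of
    equal measure; hence the factor 2. *)
Lemma sym_mu_lip {R : realType} (A B : set R) : leb_measurable B ->
  A `<=` `[0, 1[ -> B `<=` A -> sym_mu A <= sym_mu B + 2 * mu (A `\` B).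
Proof.
move=> mB A01 BA; have B01 := subset_trans BA A01.
have fA := leb_finite_unit A01; have fB := leb_finite_unit B01.
have fD : leb_finite (A `\` B) by apply: (leb_finiteS _ fA) => x [].
apply: sym_mu_le => // c.
have := reflect_le_sym_mu c mB B01.
suff : mu (A `&` reflect_set c A) <=
   mu (B `&` reflect_set c B) + (mu (A `\` B) + mu (A `\` B)) by lra.
rewrite -[X in _ + (_ + X)](mu_reflect c).
apply: (@le_trans _ _ (mu (B `&` reflect_set c B) +
    mu ((A `\` B) `|` reflect_set c (A `\` B)))).
  apply: mu_subU.
  - by apply: (leb_finiteS _ fB) => x [].
  - by apply: leb_finiteU => //; exact: leb_finite_reflect.
  - move=> x [Ax rAx]; have [Bx|nBx] := pselect (B x); last by right; left.
    have [rBx|nrBx] := pselect (B (c - x)); first by left.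
    by right; right.
by rewrite lerD2l; apply: mu_subU => //; exact: leb_finite_reflect.
Qed.

(** * Delta as a real infimum, and near-optimal sets *)

Definition admissible {R : realType} (e : R) (A : set R) : Prop :=
  [/\ leb_measurable A, A `<=` `[0, 1[ & mu A = e].

Lemma Delta_inf {R : realType} (e : R) : Delta e =
  fine (ereal_inf [set (sym_mu A)%:E | A in admissible e]).
Proof.
rewrite /Delta; congr (fine (ereal_inf _)).
apply/seteqP; split=> [_ [A [mA [A01 Ae]] <-]|_ [A [mA A01 Ae] <-]].
  exists A; last by rewrite -Dsym_fin_num.
  by split => //; rewrite /mu Ae.
exists A; last by rewrite -Dsym_fin_num.
by split=> //; split => //; rewrite -Ae leb_fin_num//; exact: leb_finite_unit.
Qed.

Lemma admissible_itv {R : realType} (e : R) : 0 <= e <= 1 ->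
  admissible e `[0, e[%classic.
Proof.
move=> /andP[e0 e1]; have [_] := mu_itvco e0; rewrite subr0 => m; split => //.
  by apply: borel_leb_measurable; exact: measurable_itv.
by move=> x; rewrite /= !in_itv/= => /andP[-> /lt_le_trans->].
Qed.

(** The infimum is finite because [[0, e[] is admissible and all values are nonnegative, so [fine]
    in [Delta] loses nothing. *)
Lemma Delta_fin_num {R : realType} (e : R) : 0 <= e <= 1 ->
  ereal_inf [set (sym_mu A)%:E | A in admissible e] = (Delta e)%:E.
Proof.
move=> e01; rewrite Delta_inf fineK// fin_numElt; apply/andP; split.
  apply: (@lt_le_trans _ _ 0%E); first exact: ltNy0.
  by apply: le_ereal_inf_tmp => _ [A [mA A01 _] <-]; rewrite lee_fin sym_mu_ge0.
apply: (@le_lt_trans _ _ (sym_mu `[0, e[%classic)%:E); last exact: ltry.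
by apply: ereal_inf_lbound; exists `[0, e[%classic => //; exact: admissible_itv.
Qed.

Lemma Delta_le {R : realType} (e : R) (A : set R) : 0 <= e <= 1 ->
  admissible e A -> Delta e <= sym_mu A.
Proof.
move=> e01 eA; rewrite -lee_fin -Delta_fin_num//.
by apply: ereal_inf_lbound; exists A.
Qed.

Lemma Delta_adherent {R : realType} (e eta : R) : 0 <= e <= 1 -> 0 < eta ->
  exists2 A, admissible e A & sym_mu A <= Delta e + eta.
Proof.
move=> e01 eta0; have := @lb_ereal_inf_adherent R
  [set (sym_mu A)%:E | A in admissible e] eta eta0.
rewrite Delta_fin_num// => /(_ isT) [_ [A eA <-]].
by rewrite -EFinD lte_fin => /ltW; exists A.
Qed.

Lemma Delta_ge0 {R : realType} (e : R) : 0 <= e <= 1 -> 0 <= Delta e.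
Proof.
move=> e01; rewrite -lee_fin -Delta_fin_num//.
by apply: le_ereal_inf_tmp => _ [A [mA A01 _] <-]; rewrite lee_fin sym_mu_ge0.
Qed.

(** * Monotonicity and the Lipschitz bound *)

(** The intermediate value theorem applies to the measure of the part of [A] in [[0, t[], which is
    nondecreasing and 1-Lipschitz in [t]. *)
Lemma exists_subset_mu {R : realType} (A : set R) (z : R) : leb_measurable A ->
  A `<=` `[0, 1[ -> 0 <= z <= mu A ->
  exists B, [/\ leb_measurable B, B `<=` A & mu B = z].
Proof.
move=> mA A01 /andP[z0 zA]; have fA := leb_finite_unit A01.
have mI (t : R) : leb_measurable `[0, t[%classic.
  by apply: borel_leb_measurable; exact: measurable_itv.
pose F (t : R) : R := mu (A `&` `[0, t[).
have fF t : leb_finite (A `&` `[0, t[) by apply: (leb_finiteS _ fA) => x [].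
have F1 (s t : R) : s <= t -> F s <= F t.
  move=> st; apply: mu_mono => // x [Ax]; rewrite /= !in_itv/= => /andP[x0 xs].
  by split => //=; rewrite ?in_itv/= x0 (lt_le_trans xs).
have F2 (s t : R) : s <= t -> F t <= F s + (t - s).
  move=> st; have [f <-] := mu_itvco st; apply: mu_subU => // x [Ax].
  rewrite /= !in_itv/= => /andP[x0 xt]; have [xs|sx] := ltP x s.
    by left; split => //=; rewrite ?in_itv/= x0.
  by right.
have cF : continuous F.
  move=> s; apply/cvgrPdist_le => e e0; near=> t.
  have : `|s - t| <= e by near: t; exact: cvgr_dist_le.
  rewrite !ler_norml; have [st|ts] := leP s t.
    by have := F1 _ _ st; have := F2 _ _ st; lra.
  by have := F1 _ _ (ltW ts); have := F2 _ _ (ltW ts); lra.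
have FA1 : F 1 = mu A by rewrite /F (setIidl A01).
have FA0 : F 0 = 0.
  have [f0 m0] := mu_itvco (lexx (0 : R)).
  apply/eqP; rewrite eq_le mu_ge0 andbT -[leRHS](subrr 0) -m0.
  by apply: mu_mono => // x [].
have [|t _ Ft] := @IVT R F 0 1 z ler01 (continuous_subspaceT cF).
  by rewrite FA0 FA1 ge_min z0 le_max zA orbT.
by exists (A `&` `[0, t[); split => //; exact: leb_measurableI.
Unshelve. all: by end_near. Qed.

Lemma Delta_mono {R : realType} (x y : R) : 0 <= x -> x <= y -> y <= 1 ->
  Delta x <= Delta y.
Proof.
move=> x0 xy y1; apply/ler_addgt0Pr => eta eta0.
have y01 : 0 <= y <= 1 by lra.
have [A [mA A01 Ay] Aeta] := Delta_adherent y01 eta0.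
have [|B [mB BA Bx]] := @exists_subset_mu _ A x mA A01; first by rewrite Ay; lra.
apply: le_trans Aeta; apply: le_trans (sym_mu_mono mA A01 BA).
apply: Delta_le; first by lra.
by split => //; exact: subset_trans A01.
Qed.

(** A near-optimal set for [x] is enlarged inside its complement in [[0, 1[], which has measure
    [1 - x] and so has room for [y - x]. *)
Lemma Delta_lip_le {R : realType} (x y : R) : 0 <= x -> x <= y -> y <= 1 ->
  Delta y <= Delta x + 2 * (y - x).
Proof.
move=> x0 xy y1; apply/ler_addgt0Pr => eta eta0.
have x01 : 0 <= x <= 1 by lra.
have [A [mA A01 Ax] Aeta] := Delta_adherent x01 eta0.
have mI : leb_measurable (`[0, 1[%classic : set R).
  by apply: borel_leb_measurable; exact: measurable_itv.
have [fI mI1] := mu_itvco (@ler01 R); rewrite subr0 in mI1.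
have IA := mu_split mA fI; rewrite (setIidr A01) mI1 Ax in IA.
have [|||C [mC CA Cyx]] := @exists_subset_mu _ (`[0, 1[ `\` A) (y - x).
- exact: leb_measurableD.
- by move=> t [].
- by lra.
have D : (A `|` C) `\` A = C.
  by apply/seteqP; split=> [t [[]//]|t Ct]; split; [right|have [] := CA _ Ct].
have mAC := leb_measurableU mA mC.
have AC01 : A `|` C `<=` `[0, 1[ by move=> t [/A01//|/CA[]].
have := @sym_mu_lip _ (A `|` C) A mA AC01 (@subsetUl _ _ _).
rewrite D Cyx => lip.
have : Delta y <= sym_mu (A `|` C).
  apply: Delta_le; first by lra.
  split => //.
  rewrite (mu_split mA (leb_finite_unit AC01)) D setUK Ax Cyx; lra.
lra.
Qed.

Lemma Delta_lip {R : realType} (x y : R) : 0 <= x <= 1 -> 0 <= y <= 1 ->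
  `|Delta x - Delta y| <= 2 * `|x - y|.
Proof.
move=> x01 y01; wlog xy : x y x01 y01 / x <= y => [H|].
  have [/H|/ltW/H] := leP x y; first exact.
  by rewrite distrC [`|y - x|]distrC; exact.
rewrite ler0_norm ?[`|x - y|]ler0_norm ?subr_le0//.
  by have := @Delta_lip_le _ x y; lra.
by apply: Delta_mono; lra.
Qed.

(** * Continuity of translation in measure *)

(** Take an open [U] around [A] with little excess. If [x] is in [A] but [x + h] is not, then either
    [x] is close to the complement of [U], or [x + h] lies in [U \ A]; both events have small
    measure. *)
Lemma mu_shift_continuous {R : realType} (A : set R) (e : R) :
  leb_measurable A -> leb_finite A -> 0 < e ->
  exists2 d, 0 < d & forall h, `|h| < d -> mu (A `\` shift_set h A) <= e.
Proof.
move=> mA fA e0; have e20 : 0 < e / 2 by rewrite divr_gt0.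
have [U [oU AU Ue]] := outer_measure_open_le A e20.
have {}Ue : (leb (U : set (LebT R)) <= leb (A : set (LebT R)) + (e / 2)%:E)%E by [].
have fU : leb_finite U.
  by apply: le_lt_trans Ue _; rewrite leb_fin_num// -EFinD ltry.
have UA : mu (U `\` A) <= e / 2.
  have := mu_split mA fU; rewrite (setIidr AU).
  by move: Ue; rewrite !leb_fin_num// -EFinD lee_fin; lra.
(* Small translates of the eroded set V n stay inside U. *)
pose V (n : nat) := [set x : R | forall y, `|x - y| < n.+1%:R^-1 -> U y].
have VU n : V n `<=` U by move=> x; apply; rewrite subrr normr0 invr_gt0.
have mV n : leb_measurable (V n).
  rewrite -[V n]setCK; apply: measurableC; apply: open_leb_measurable.
  rewrite (_ : ~` V n = \bigcup_(y in ~` U) ball y n.+1%:R^-1).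
    by apply: bigcup_open => y _; exact: ball_open.
  apply/seteqP; split=> [x /existsNP[y /not_implyP[xy Uy]]|x [y Uy xy] /(_ y)].
    by exists y => //; rewrite /ball/= distrC.
  by move: xy; rewrite /ball/= distrC => xy /(_ xy).
have UV : \bigcup_n V n = U.
  apply/seteqP; split=> [x [n _ /VU]//|x Ux].
  move: oU; rewrite openE => /(_ _ Ux) /nbhs_ballP[r /= r0 rU].
  have [n _ nr] : \forall n \near \oo, n.+1%:R^-1 < r.
    exact: near_infty_natSinv_lt (PosNum r0).
  exists n => // y xy; apply: rU; apply: lt_trans (nr n _) => //=.
have := @nondecreasing_cvg_mu _ (LebT R) R leb V mV.
rewrite UV => /(_ (open_leb_measurable oU)) Vcvg.
have {}Vcvg : leb (V n : set (LebT R)) @[n --> \oo] --> (mu U)%:E.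
  rewrite -leb_fin_num//; apply: Vcvg => n m nm; apply/subsetPset => x Vx y xy.
  by apply: Vx; apply: lt_le_trans xy _; rewrite lef_pV2 ?posrE// ler_nat ltnS.
move/fine_cvgP : Vcvg => [_ /cvgrPdist_lt /(_ _ e20) [n _ /(_ n (leqnn n))]].
rewrite /= -/(mu (V n)) => Vn; exists n.+1%:R^-1; first by rewrite invr_gt0.
move=> h hn; have fUV : leb_finite (U `\` V n) by apply: (leb_finiteS _ fU) => x [].
have fUA : leb_finite (U `\` A) by apply: (leb_finiteS _ fU) => x [].
have UVn : mu (U `\` V n) <= e / 2.
  have := mu_split (mV n) fU; rewrite (setIidr (VU n)).
  by have := ler_norm (mu U - mu (V n)); lra.
apply: (@le_trans _ _ (mu (U `\` V n) + mu (shift_set h (U `\` A)))).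
  apply: mu_subU => //; first exact: leb_finite_shift.
  move=> x [Ax Ahx]; have [Vx|nVx] := pselect (V n x); [right|left].
    by split => //; apply: Vx; rewrite opprD addrA subrr add0r normrN.
  by split => //; exact: AU.
by rewrite mu_shift; lra.
Qed.

(** * Periodic cells and equidistribution *)

(** The line is cut into intervals of length [1 / L], numbered by the integers and coloured by
    residue modulo [N], so the pattern has period [N / L]. The absolute value only converts the
    nonnegative residue to [nat]. *)
Definition cell {R : realType} (N : nat) (L x : R) : nat :=
  `|(Num.floor (L * x)%R %% N%:Z)%Z|%N.

Lemma cellE {R : realType} (N : nat) (L x : R) : (0 < N)%N ->
  (cell N L x)%:Z = (Num.floor (L * x) %% N%:Z)%Z.
Proof. by move=> N0; rewrite gez0_abs// modz_ge0// -lt0n. Qed.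

Lemma cell_lt {R : realType} (N : nat) (L x : R) : (0 < N)%N ->
  (cell N L x < N)%N.
Proof. by move=> N0; rewrite -ltz_nat cellE// ltz_pmod. Qed.

Lemma cell_shift {R : realType} (N : nat) (L x : R) (i : nat) : (0 < N)%N ->
  0 < L -> (i < N)%N ->
  cell N L (x + (i%:R - (cell N L x)%:R) / L) = i.
Proof.
move=> N0 L0 iN; apply/eqP; rewrite -eqz_nat; apply/eqP; rewrite cellE//.
rewrite mulrDr [L * (_ / L)]mulrC divfK ?gt_eqF//.
rewrite (_ : i%:R - _ = (i%:Z - (cell N L x)%:Z)%:~R); last by rewrite rmorphB.
rewrite floorDrz ?intr_int// intrKfloor cellE//.
set f := Num.floor _.
rewrite (_ : f + _ = (f %/ N%:Z)%Z * N%:Z + i%:Z); last first.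
  by rewrite {1}(divz_eq f N%:Z); ring.
by rewrite modzMDl modz_small.
Qed.

Definition cells {R : realType} (N : nat) (L : R) (s : seq nat) : set R :=
  [set x | cell N L x \in s].

Lemma leb_measurable_cells {R : realType} (N : nat) (L : R) (s : seq nat) :
  (0 < N)%N -> 0 < L -> leb_measurable (cells N L s).
Proof.
move=> N0 L0.
have -> : cells N L s = \bigcup_(z in setT) (if `|(z %% N%:Z)%Z|%N \in s
    then `[z%:~R / L, (z + 1)%:~R / L[%classic else set0).
  apply/seteqP; split=> [x xs|x [z _]].
    exists (Num.floor (L * x)) => //; rewrite -/(cell N L x).
    rewrite (_ : cell N L x \in s)//= in_itv/=.
    by rewrite ler_pdivrMr// ltr_pdivlMr// mulrC floor_itv.
  case: ifP => // zs; rewrite /= in_itv/= ler_pdivrMr// ltr_pdivlMr// mulrC.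
  by move=> /floor_def zx; rewrite /cells/= /cell zx.
apply: countable_bigcupT_measurable => [|z]; first exact: countableP.
by case: ifP => _; [apply: borel_leb_measurable; exact: measurable_itv|
  exact: measurable0].
Qed.

Lemma mu_cells {R : realType} (G : set R) (N : nat) (L : R) (s : seq nat) :
  (0 < N)%N -> 0 < L -> leb_finite G -> uniq s ->
  mu (G `&` cells N L s) = \sum_(i <- s) mu (G `&` cells N L [:: i]).
Proof.
move=> N0 L0 fG; elim: s => [_|a s IH /= /andP[nas us]].
  rewrite big_nil (_ : _ `&` _ = set0); last first.
    by apply/seteqP; split=> x // [].
  by rewrite /mu (_ : leb _ = 0%E)//; exact: measure0.
rewrite big_cons -IH// (mu_split (leb_measurable_cells [:: a] N0 L0)); last first.
  by apply: (leb_finiteS _ fG) => x [].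
congr (mu _ + mu _); apply/seteqP; split=> x; rewrite /cells/= !inE.
- by move=> [[]].
- by move=> [Gx ->].
- by move=> [[Gx /predU1P[xa|//]] /negP]; rewrite xa eqxx.
- move=> [Gx xs]; split; first by rewrite xs orbT.
  by move=> /eqP xa; rewrite -xa xs in nas.
Qed.

(* Cells of different residues are translates of one another by less than N / L. *)
Lemma mu_cells_equidistributed {R : realType} (G : set R) (N : nat) (L eta : R)
    (s : seq nat) : (0 < N)%N -> 0 < L -> leb_finite G ->
  (forall h, `|h| < N%:R / L -> mu (G `\` shift_set h G) <= eta) ->
  uniq s -> all (fun i => (i < N)%N) s ->
  `|mu (G `&` cells N L s) - (size s)%:R * (mu G / N%:R)| <= (size s)%:R * eta.
Proof.
move=> N0 L0 fG Gh us sN; have N0R : 0 < N%:R :> R by rewrite ltr0n.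
have fGc t : leb_finite (G `&` cells N L t) by apply: (leb_finiteS _ fG) => x [].
have step i j : (i < N)%N -> (j < N)%N ->
    mu (G `&` cells N L [:: i]) <= mu (G `&` cells N L [:: j]) + eta.
  move=> iN jN; pose h : R := (j%:R - i%:R) / L.
  have hN : `|h| < N%:R / L.
    rewrite /h normrM [`|L^-1|]gtr0_norm ?invr_gt0// ltr_pM2r ?invr_gt0//.
    rewrite ltr_norml -(ltr_nat R) in iN *; rewrite -(ltr_nat R) in jN.
    have := ler0n R i; have := ler0n R j; lra.
  apply: (@le_trans _ _ (mu (shift_set h (G `&` cells N L [:: j])) +
      mu (G `\` shift_set h G))); last by rewrite mu_shift lerD2l Gh.
  apply: mu_subU; first exact: leb_finite_shift.
    by apply: (leb_finiteS _ fG) => x [].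
  move=> x [Gx]; rewrite /cells/= inE => /eqP xi.
  have [Gxh|] := pselect (G (x + h)); last by right.
  left; split => //; rewrite /= inE; apply/eqP.
  by rewrite /h -xi cell_shift.
have GE : mu G = \sum_(i <- iota 0 N) mu (G `&` cells N L [:: i]).
  rewrite -mu_cells// ?iota_uniq//; congr mu; apply/esym/setIidl => x _.
  by rewrite /cells/= mem_iota cell_lt.
(* Comparing one cell with each of the [N] cells and summing compares it with their average. *)
have one i : (i < N)%N -> `|mu (G `&` cells N L [:: i]) - mu G / N%:R| <= eta.
  move=> iN.
  have sumc (z : R) : \sum_(j <- iota 0 N) z = N%:R * z.
    by rewrite big_const_seq count_predT size_iota iter_addr_0 mulr_natl.
  have up : N%:R * mu (G `&` cells N L [:: i]) <= mu G + N%:R * eta.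
    rewrite -!sumc GE -big_split/= big_seq [leRHS]big_seq.
    by apply: ler_sum => j; rewrite mem_iota => /andP[_ jN]; exact: step.
  have lo : mu G <= N%:R * (mu (G `&` cells N L [:: i]) + eta).
    rewrite -sumc GE big_seq [leRHS]big_seq.
    by apply: ler_sum => j; rewrite mem_iota => /andP[_ jN]; exact: step.
  have GN : N%:R * (mu G / N%:R) = mu G by rewrite mulrC divfK ?gt_eqF.
  rewrite ler_norml -(ler_pM2l N0R) -[X in _ && X](ler_pM2l N0R).
  by rewrite !mulrBr GN mulrN; lra.
rewrite mu_cells//; elim: s us sN => [_ _|a s IH /= /andP[_ us] /andP[aN sN]].
  by rewrite big_nil !mul0r subrr normr0.
rewrite big_cons -natr1; move: (IH us sN) (one a aN).
by rewrite !ler_norml; lra.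
Qed.

(** The floor of a sum is the sum of the floors plus a carry [t] equal to 0 or 1. *)
Lemma cell_reflect {R : realType} (N : nat) (L c x : R) : (0 < N)%N ->
  exists t : bool, cell N L c = ((cell N L x + cell N L (c - x) + t) %% N)%N.
Proof.
move=> N0; set a := Num.floor (L * x); set b := Num.floor (L * (c - x)).
have [t ct] : exists t : bool, Num.floor (L * c) = a + b + t%:Z.
  have /andP[a1 a2] : a%:~R <= L * x < (a + 1)%:~R := floor_itv _.
  have /andP[b1 b2] : b%:~R <= L * (c - x) < (b + 1)%:~R := floor_itv _.
  rewrite mulrBr in b1 b2; rewrite !intrD in a2 b2.
  have [cab|cab] := ltP (L * c) (a + b + 1)%:~R.
    by exists false; apply: floor_def; rewrite addr0 cab !intrD; lra.
  by exists true; apply: floor_def; rewrite cab/= !intrD/=; lra.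
exists t; apply/eqP; rewrite -eqz_nat; apply/eqP.
rewrite cellE// ct -modz_nat !PoszD !cellE// -/a -/b.
by rewrite -[LHS]modzDml -[RHS]modzDml modzDm.
Qed.

(** * The powers of 3 as a Sidon set modulo [3 ^ k] *)

Definition powers3 (k : nat) : seq nat := [seq (3 ^ a)%N | a <- iota 0 k].

Lemma powers3_uniq (k : nat) : uniq (powers3 k).
Proof. by rewrite map_inj_uniq ?iota_uniq// => a b /eqP; rewrite eqn_exp2l// => /eqP. Qed.

Lemma powers3_lt (k : nat) : all (fun i => (i < 3 ^ k)%N) (powers3 k).
Proof.
by apply/allP => _ /mapP[a + ->]; rewrite mem_iota => /andP[_ ak]; rewrite ltn_exp2l.
Qed.

(** The larger exponents must agree, since two powers up to [3 ^ v] sum to less than [3 ^ v.+1];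
    cancelling then matches the smaller ones. *)
Lemma sum_powers3_inj (a b c d : nat) : (3 ^ a + 3 ^ b = 3 ^ c + 3 ^ d)%N ->
  c = a \/ c = b.
Proof.
have key x y u v : (x <= y -> u <= v -> 3 ^ x + 3 ^ y = 3 ^ u + 3 ^ v -> y <= v)%N.
  move=> xy uv E; rewrite leqNgt; apply/negP => vy.
  have h1 : (3 ^ u <= 3 ^ v)%N by rewrite leq_exp2l.
  have h2 : (3 ^ v.+1 <= 3 ^ y)%N by rewrite leq_exp2l.
  have h3 : (0 < 3 ^ x)%N by rewrite expn_gt0.
  by rewrite expnS in h2; lia.
have ord x y u v : (x <= y -> u <= v -> 3 ^ x + 3 ^ y = 3 ^ u + 3 ^ v ->
    x = u /\ y = v)%N.
  move=> xy uv E; have yv : y = v.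
    by apply/eqP; rewrite eqn_leq (key x y u v)// (key u v x y).
  split=> //; apply/eqP; rewrite -(@eqn_exp2l 3)//; apply/eqP.
  by move: E; rewrite yv; exact: addIn.
move=> E; have [ab|/ltnW ba] := leqP a b; have [cd|/ltnW dc] := leqP c d.
- by have [] := ord a b c d ab cd E; left.
- by have [] := ord a b d c ab dc (etrans E (addnC _ _)); right.
- by have [] := ord b a c d ba cd (etrans (addnC _ _) E); right.
- by have [] := ord b a d c ba dc (etrans (etrans (addnC _ _) E) (addnC _ _)); left.
Qed.

(** Each term is at most a third of [3 ^ k]. No sum wraps around, so the Sidon property survives
    modulo [3 ^ k]. *)
Lemma powers3_add_lt (k u v : nat) :
  u \in powers3 k -> v \in powers3 k -> (u + v < 3 ^ k)%N.
Proof.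
case: k => // k /mapP[a + ->] /mapP[b + ->].
rewrite !mem_iota /= !add0n !ltnS => ak bk.
have : (3 ^ a <= 3 ^ k)%N by rewrite leq_exp2l.
have : (3 ^ b <= 3 ^ k)%N by rewrite leq_exp2l.
have : (0 < 3 ^ k)%N by rewrite expn_gt0.
by rewrite expnS; lia.
Qed.

(** Here [m] stands for the cell of the reflection parameter and [t] for the carry of
    [cell_reflect]. *)
Definition powers3_summands (k t m : nat) : pred nat := fun u =>
  has (fun v => (u + v + t) %% 3 ^ k == m)%N (powers3 k).

(** Once [u0 + v0] represents the residue, the Sidon property leaves only [u0] and [v0] as
    summands. *)
Lemma count_powers3_summands (k t m : nat) :
  (count (powers3_summands k t m) (powers3 k) <= 2)%N.
Proof.
rewrite -size_filter; set s := seq.filter _ _.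
have [->|[u0 u0s]] : s = [::] \/ exists u0, u0 \in s.
  by case: s => [|u0 s]; [left|right; exists u0; rewrite mem_head].
  by [].
move: (u0s); rewrite mem_filter => /andP[/hasP[v0 v0S /eqP E0] u0S].
apply: (@uniq_leq_size _ s [:: u0; v0]); first exact: filter_uniq (powers3_uniq k).
move=> u; rewrite mem_filter => /andP[/hasP[v vS /eqP]]; rewrite -E0 => E uS.
have {}E : (u0 + v0 = u + v)%N.
  move/eqP: E; rewrite eqn_modDr.
  by rewrite !modn_small ?powers3_add_lt// => /eqP.
move: u0S v0S uS vS E => /mapP[a _ ->] /mapP[b _ ->] /mapP[c _ ->] /mapP[d _ ->].
by move=> /sum_powers3_inj[->|->]; rewrite !inE eqxx ?orbT.
Qed.

(** * The thinning step *)

(** This keeps the factor [1 - 2q] nonnegative for [q = k / 3 ^ k]. *)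
Lemma leq_double_exp3 (k : nat) : (2 * k <= 3 ^ k)%N.
Proof.
elim: k => // k IH; have : (0 < 3 ^ k)%N by rewrite expn_gt0.
by rewrite expnS; lia.
Qed.

(** Translating by [h] moves the reflected factor by [- h] before reflection, so each factor
    contributes one [eta]. The bound is uniform in [c]. *)
Lemma mu_reflectI_shift {R : realType} (A : set R) (c d eta : R) : leb_finite A ->
  (forall h, `|h| < d -> mu (A `\` shift_set h A) <= eta) ->
  forall h, `|h| < d -> mu ((A `&` reflect_set c A) `\`
    shift_set h (A `&` reflect_set c A)) <= 2 * eta.
Proof.
move=> fA Ad h hd.
have fD u : leb_finite (A `\` shift_set u A) by apply: (leb_finiteS _ fA) => x [].
apply: (@le_trans _ _ (mu (A `\` shift_set h A) +
    mu (reflect_set c (A `\` shift_set (- h) A)))).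
  apply: mu_subU => //; first exact: leb_finite_reflect.
  move=> x [[Ax Acx] nG]; have [Axh|nAxh] := pselect (A (x + h)); [right|left].
    split => //; move: nG; rewrite /shift_set /reflect_set/= opprD addrA.
    by move=> nG nA; apply: nG; split.
  by split.
by rewrite mu_reflect; have := Ad _ hd; have := Ad (- h); rewrite normrN => /(_ hd); lra.
Qed.

(* Removing from A a fine periodic copy T of the Sidon set of powers of 3, of
   density q = k / 3 ^ k, changes 1_A * 1_A by -2 q 1_A * 1_A, up to
   1_T * 1_T, which is only O(3 ^ -k) = o(q). *)
Lemma Delta_thin {R : realType} (k : nat) (e : R) : 0 <= e <= 1 ->
  Delta ((1 - k%:R / (3 ^ k)%:R) * e) <=
    (1 - 2 * (k%:R / (3 ^ k)%:R)) * Delta e + 4 / (3 ^ k)%:R.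
Proof.
move=> e01; apply/ler_addgt0Pr => eps eps0.
set N := (3 ^ k)%N; have N0 : (0 < N)%N by rewrite expn_gt0.
have N0R : 0 < N%:R :> R by rewrite ltr0n.
have k0 : 0 <= k%:R :> R by rewrite ler0n.
have kN : 2 * (k%:R / N%:R) <= 1 :> R.
  by rewrite mulrA ler_pdivrMr// mul1r -natrM ler_nat leq_double_exp3.
have q0 : 0 <= k%:R / N%:R :> R by rewrite divr_ge0// ltW.
set q : R := k%:R / N%:R in kN q0 *.
(* The errors are [4k + 5] times [eta] in the bound on [sym_mu (A \ T)], and [2k] times [eta] from
   correcting the measure of [A \ T] at the end. *)
pose eta := eps / (6 * k%:R + 5).
have eta0 : 0 < eta by rewrite divr_gt0//; lra.
have etaE : (6 * k%:R + 5) * eta = eps by rewrite mulrC divfK// gt_eqF//; lra.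
have [A [mA A01 Ae] Aeta] := Delta_adherent e01 eta0.
have fA := leb_finite_unit A01.
have [d d0 Ad] := mu_shift_continuous mA fA eta0.
(* The period [N / L] of the pattern is exactly [d], the scale below which translation barely
   changes [A]. *)
pose L := N%:R / d; have L0 : 0 < L by rewrite divr_gt0.
have NL : N%:R / L = d by rewrite /L invf_div mulrC divfK// gt_eqF.
pose T : set R := cells N L (powers3 k).
have mT : leb_measurable T by exact: leb_measurable_cells.
have sS : size (powers3 k) = k by rewrite size_map size_iota.
have AT : `|mu (A `&` T) - k%:R * (e / N%:R)| <= k%:R * eta.
  have := @mu_cells_equidistributed _ A N L eta (powers3 k) N0 L0 fA.
  by rewrite NL Ae sS; apply => //; [exact: powers3_uniq|exact: powers3_lt].
have BE := mu_split mT fA; rewrite Ae in BE.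
have B01 : A `\` T `<=` `[0, 1[ by move=> x [/A01].
have symB : sym_mu (A `\` T) <=
    (1 - 2 * q) * (Delta e + eta) + 4 * k%:R * eta + (4 / N%:R + 4 * eta).
  apply: sym_mu_le => // c; pose G := A `&` reflect_set c A.
  have fGs (X : set R) : X `<=` A -> leb_finite X by move=> XA; exact: leb_finiteS XA fA.
  have mrT : leb_measurable (reflect_set c T) by exact: leb_measurable_reflect.
  have GT : `|mu (G `&` T) - k%:R * (mu G / N%:R)| <= k%:R * (2 * eta).
    have := @mu_cells_equidistributed _ G N L (2 * eta) (powers3 k) N0 L0.
    rewrite NL sS; apply.
    - by apply: fGs => x [].
    - exact: mu_reflectI_shift.
    - exact: powers3_uniq.
    - exact: powers3_lt.
  (* The reflection preserves [G] and exchanges [T] with [c - T]. *)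
  have GrT : mu (G `&` reflect_set c T) = mu (G `&` T).
    rewrite -(mu_reflect c (G `&` T)); congr mu.
    apply/seteqP; split=> x [[A1 A2] Tcx]; split => //; split => //.
    - by rewrite /reflect_set/= subKr.
    - by move: A2; rewrite /reflect_set/= subKr.
  (* These residues contain the cell of every [x] with both [x] and [c - x] in [T]: at most two for
     each carry, hence at most four. *)
  pose s := [seq u <- powers3 k |
    predU (powers3_summands k 0 (cell N L c)) (powers3_summands k 1 (cell N L c)) u].
  have s4 : (size s <= 4)%N.
    rewrite size_filter; apply: (@leq_trans (2 + 2)%N) => //.
    apply: leq_trans (leq_add (count_powers3_summands k 0 (cell N L c))
      (count_powers3_summands k 1 (cell N L c))).
    by rewrite -count_predUI leq_addr.
  have TT : mu (G `&` reflect_set c T `&` T) <= 4 / N%:R + 4 * eta.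
    apply: (@le_trans _ _ (mu (A `&` cells N L s))).
      apply: mu_mono; first by apply: fGs => x [].
      move=> x [[[Ax _] rTx] Tx]; split => //; rewrite /cells/= mem_filter.
      rewrite (_ : cell N L x \in powers3 k) ?andbT//=.
      have [t ct] := @cell_reflect _ N L c x N0.
      have P : powers3_summands k t (cell N L c) (cell N L x).
        by apply/hasP; exists (cell N L (c - x)) => //; rewrite ct.
      by case: t {ct} P => ->; rewrite ?orbT.
    have := @mu_cells_equidistributed _ A N L eta s N0 L0 fA.
    rewrite NL Ae => /(_ Ad (filter_uniq _ (powers3_uniq k))).
    have -> : all (fun i => (i < N)%N) s.
      apply/allP => i; rewrite mem_filter => /andP[_].
      exact: (allP (powers3_lt k)).
    move=> /(_ isT) /ler_normlW.
    have eN : e / N%:R <= N%:R^-1 by rewrite ler_pdivrMr// mulVf ?gt_eqF//; lra.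
    have eN0 : 0 <= e / N%:R by apply: divr_ge0; lra.
    have : (size s)%:R * (e / N%:R) <= 4 * (e / N%:R).
      by apply: ler_wpM2r => //; rewrite ler_nat.
    have : (size s)%:R * eta <= 4 * eta by rewrite ler_pM2r// ler_nat.
    lra.
  have -> : (A `\` T) `&` reflect_set c (A `\` T) = (G `\` T) `\` reflect_set c T.
    by apply/seteqP; split=> [x [[? ?] [? ?]]|x [[[? ?] ?] ?]].
  (* Inclusion-exclusion: what remains of [G] has measure [mu G] minus twice [mu (G & T)], plus the
     small double intersection. *)
  have e1 : mu G = mu (G `&` T) + mu (G `\` T).
    by apply: mu_split => //; apply: fGs => x [].
  have e2 : mu (G `\` T) =
      mu ((G `\` T) `&` reflect_set c T) + mu ((G `\` T) `\` reflect_set c T).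
    by apply: mu_split => //; apply: fGs => x [[]].
  have e3 : mu (G `&` reflect_set c T) =
      mu (G `&` reflect_set c T `&` T) + mu ((G `\` T) `&` reflect_set c T).
    rewrite [X in _ = _ + X](_ : _ = mu ((G `&` reflect_set c T) `\` T)).
      by apply: mu_split => //; apply: fGs => x [[]].
    by congr mu; apply/seteqP; split=> x [[? ?] ?].
  have GA : mu G <= sym_mu A by exact: reflect_le_sym_mu.
  have GD : (1 - 2 * q) * mu G <= (1 - 2 * q) * (Delta e + eta).
    by apply: ler_wpM2l; lra.
  have qG : k%:R * (mu G / N%:R) = q * mu G by rewrite /q; ring.
  by move: GT; rewrite ler_norml qG; lra.
have qe : k%:R * (e / N%:R) = q * e by rewrite /q; ring.
have B1 : 0 <= mu (A `\` T) <= 1 by rewrite mu_ge0 mu_unit_le1.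
have DB : Delta (mu (A `\` T)) <= sym_mu (A `\` T).
  by apply: Delta_le => //; split => //; exact: leb_measurableD.
have qe01 : 0 <= (1 - q) * e <= 1.
  by apply/andP; split; [apply: mulr_ge0; lra|apply: mulr_ile1; lra].
(* The set [A \ T] has measure only approximately [(1 - q) * e]; the Lipschitz bound absorbs the
   discrepancy. *)
have := Delta_lip qe01 B1; move/ler_normlW.
have : `|(1 - q) * e - mu (A `\` T)| <= k%:R * eta.
  by move: AT; rewrite qe !ler_norml; lra.
have : 0 <= q * eta by rewrite mulr_ge0// ltW.
lra.
Qed.

(** * Iterated thinning and monotonicity of the quotient *)

(** It gives [q <= 1 / k], so the density tends to 0 as [k] grows. *)
Lemma leq_sqr_exp3 (k : nat) : (k ^ 2 <= 3 ^ k)%N.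
Proof.
elim: k => // k IH; have := leq_double_exp3 k.
have : (0 < 3 ^ k)%N by rewrite expn_gt0.
by rewrite [(3 ^ k.+1)%N]expnS -!mulnn in IH *; lia.
Qed.

(** Since [1 - 2q] is at most the square of [1 - q], each step scales the bound like the square of
    the measure. The factors are at most 1, so errors merely add up. *)
Lemma Delta_thin_iter {R : realType} (k n : nat) (y : R) : 0 <= y <= 1 ->
  Delta ((1 - k%:R / (3 ^ k)%:R) ^+ n * y) <=
    ((1 - k%:R / (3 ^ k)%:R) ^+ n) ^+ 2 * Delta y + n%:R * (4 / (3 ^ k)%:R).
Proof.
move=> y01; have fy := Delta_ge0 y01.
have N0R : 0 < (3 ^ k)%:R :> R by rewrite ltr0n expn_gt0.
set N : R := (3 ^ k)%:R in N0R *.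
have q0 : 0 <= k%:R / N by rewrite divr_ge0// ltW.
have q1 : 2 * (k%:R / N) <= 1.
  by rewrite mulrA ler_pdivrMr// mul1r -natrM ler_nat leq_double_exp3.
set q := k%:R / N in q0 q1 *; elim: n => [|n IH].
  by rewrite !expr0 expr1n !mul1r mul0r addr0.
have r01 : 0 <= (1 - q) ^+ n <= 1 by rewrite exprn_ge0 ?exprn_ile1//; lra.
have ry01 : 0 <= (1 - q) ^+ n * y <= 1.
  by apply/andP; split; [apply: mulr_ge0|apply: mulr_ile1]; lra.
rewrite exprS -mulrA; apply: (le_trans (Delta_thin k ry01)); rewrite -/N -/q.
set r := (1 - q) ^+ n in r01 ry01 IH *.
have N40 : 0 <= 4 / N by rewrite divr_ge0// ltW.
have fr := Delta_ge0 ry01.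
have h1 : (1 - 2 * q) * Delta (r * y) <= (1 - q) ^+ 2 * Delta (r * y).
  by apply: ler_wpM2r => //; rewrite sqrrB; have := sqr_ge0 q; lra.
have h2 : (1 - q) ^+ 2 * Delta (r * y) <=
    (1 - q) ^+ 2 * (r ^+ 2 * Delta y) + n%:R * (4 / N).
  apply: (@le_trans _ _ ((1 - q) ^+ 2 * (r ^+ 2 * Delta y + n%:R * (4 / N)))).
    by apply: ler_wpM2l => //; exact: sqr_ge0.
  have q21 : (1 - q) ^+ 2 <= 1 by apply: exprn_ile1; lra.
  by rewrite mulrDr lerD2l ler_piMl// mulr_ge0.
rewrite exprMn -natr1 mulrDl mul1r -mulrA; lra.
Qed.

(** A Bernoulli-type bound, used to limit how many thinning steps fit between [y] and [x]. *)
Lemma expr_subr_le {R : realType} (q : R) (n : nat) : 0 <= q <= 1 ->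
  (1 - q) ^+ n * (1 + n%:R * q) <= 1.
Proof.
move=> q01; elim: n => [|n IH]; first by rewrite expr0 mul0r addr0 mulr1.
apply: le_trans IH; rewrite exprSr -mulrA; apply: ler_wpM2l.
  by apply: exprn_ge0; lra.
have : 0 <= n%:R * q ^+ 2 by rewrite mulr_ge0// sqr_ge0.
by rewrite -natr1; have := sqr_ge0 q; lra.
Qed.

(** Thinning stops at the last [n] whose measure is still at least [x]. One more step would pass
    below [x], and the factor on the left pays for that step. *)
Lemma Delta_scale_approx {R : realType} (k : nat) (x y : R) : (0 < k)%N ->
  0 < x -> x <= y -> y <= 1 ->
  (1 - k%:R / (3 ^ k)%:R) ^+ 2 * Delta x <=
    (x / y) ^+ 2 * Delta y + 4 * (y / x) / k%:R.
Proof.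
move=> k0 x0 xy y1; have y0 : 0 < y by exact: lt_le_trans xy.
have y01 : 0 <= y <= 1 by lra.
have fy := Delta_ge0 y01.
have k0R : 0 < k%:R :> R by rewrite ltr0n.
have N0R : 0 < (3 ^ k)%:R :> R by rewrite ltr0n expn_gt0.
have iter n := Delta_thin_iter k n y01.
set N : R := (3 ^ k)%:R in N0R iter *.
have q0 : 0 < k%:R / N by rewrite divr_gt0.
have q1 : 2 * (k%:R / N) <= 1.
  by rewrite mulrA ler_pdivrMr// mul1r -natrM ler_nat leq_double_exp3.
(* The error per step is [4q / k]; as [n * q] stays below [y / x], the total is at most
   [4 * (y / x) / k]. *)
have N4 : 4 / N = 4 * (k%:R / N) / k%:R by field; rewrite !gt_eqF.
rewrite N4 in iter; set q := k%:R / N in q0 q1 iter *.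
have nq n : x <= (1 - q) ^+ n * y -> n%:R * q <= y / x.
  move=> xn; rewrite ler_pdivlMr//.
  have := @expr_subr_le _ q n; have nq0 : 0 <= n%:R * q by rewrite mulr_ge0// ltW.
  move=> /(_ _)/(ler_wpM2r (ltW y0)) H.
  have : x * (1 + n%:R * q) <= y.
    rewrite -[leRHS]mul1r; apply: le_trans (H _); last by lra.
    by rewrite mulrAC; apply: ler_wpM2r => //; lra.
  lra.
pose P n := x <= (1 - q) ^+ n * y.
have exP : exists n, P n by exists 0%N; rewrite /P expr0 mul1r.
have ubP n : P n -> (n <= Num.bound (y / x / q))%N.
  move=> /nq; rewrite -ler_pdivlMr// => nb.
  rewrite -(ler_nat R) (le_trans nb)// ltW// archi_boundP//.
  by rewrite !divr_ge0// ltW.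
case: (ex_maxnP exP ubP) => n Pn maxn.
have xn : (1 - q) ^+ n.+1 * y < x.
  by rewrite ltNge; apply/negP => /maxn; rewrite ltnn.
have r0 : 0 <= (1 - q) ^+ n.+1 by apply: exprn_ge0; lra.
have r1 : (1 - q) ^+ n <= 1 by apply: exprn_ile1; lra.
have fx : Delta x <= ((1 - q) ^+ n) ^+ 2 * Delta y + n%:R * (4 * q / k%:R).
  apply: le_trans (iter n); apply: Delta_mono => //; first exact: ltW.
  by apply: mulr_ile1; rewrite ?exprn_ge0//; lra.
have q2 : 0 <= (1 - q) ^+ 2 by exact: sqr_ge0.
apply: (le_trans (ler_wpM2l q2 fx)); rewrite mulrDr; apply: lerD.
  rewrite mulrA; apply: ler_wpM2r => //.
  rewrite -exprMn -exprS ler_sqr ?nnegrE ?divr_ge0 ?(ltW x0) ?(ltW y0)//.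
  by rewrite ler_pdivlMr// ltW.
have E : n%:R * (4 * q / k%:R) = 4 * (n%:R * q) / k%:R by ring.
rewrite E; apply: (@le_trans _ _ (4 * (n%:R * q) / k%:R)).
  have q21 : (1 - q) ^+ 2 <= 1 by apply: exprn_ile1; lra.
  by rewrite ler_piMl// !(divr_ge0, mulr_ge0)// ltW.
by rewrite ler_pM2r ?invr_gt0// ler_pM2l// nq.
Qed.

Lemma Delta_scale {R : realType} (x y : R) : 0 < x -> x <= y -> y <= 1 ->
  Delta x / x ^+ 2 <= Delta y / y ^+ 2.
Proof.
move=> x0 xy y1; have y0 : 0 < y by exact: lt_le_trans xy.
have x01 : 0 <= x <= 1 by lra.
suff : Delta x <= (x / y) ^+ 2 * Delta y.
  rewrite ler_pdivrMr ?exprn_gt0//.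
  rewrite (_ : (x / y) ^+ 2 * Delta y = Delta y / y ^+ 2 * x ^+ 2)//.
  by field; rewrite gt_eqF.
apply/ler_addgt0Pr => eps eps0.
have fx := Delta_ge0 x01.
(* The first term is the accumulated error; the second is the cost of replacing the squared factor
   by [1 - 2 / k]. Then [k] is chosen above [C / eps]. *)
pose C := 4 * (y / x) + 2 * Delta x.
have C0 : 0 <= C by apply: addr_ge0; apply: mulr_ge0 => //; rewrite divr_ge0// ltW.
pose k := (Num.bound (C / eps)).+1.
have k0R : 0 < k%:R :> R by rewrite ltr0n.
have Ck : C / k%:R <= eps.
  rewrite ler_pdivrMr// mulrC -ler_pdivrMr// ltW//.
  rewrite (lt_trans (archi_boundP _)) ?ltr_nat//.
  by rewrite divr_ge0// ltW.
have := @Delta_scale_approx _ k x y isT x0 xy y1.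
have qk : k%:R / (3 ^ k)%:R <= k%:R^-1 :> R.
  rewrite ler_pdivrMr ?ltr0n ?expn_gt0// mulrC ler_pdivlMr//.
  by rewrite -natrM ler_nat mulnn leq_sqr_exp3.
set q : R := k%:R / _ in qk *.
have h1 : (1 - 2 * k%:R^-1) * Delta x <= (1 - q) ^+ 2 * Delta x.
  by apply: ler_wpM2r => //; rewrite sqrrB; have := sqr_ge0 q; lra.
have -> : 4 * (y / x) / k%:R = C / k%:R - 2 * k%:R^-1 * Delta x.
  by rewrite /C; ring.
lra.
Qed.

Theorem theorem1p1 (R : realType) :
  (forall x y : R, x \in `]0, 1] -> y \in `]0, 1] ->
     `|Delta x - Delta y| <= 2 * `|x - y|) /\
  {within `]0, 1], continuous (@Delta R)} /\
  (forall x y : R, x \in `]0, 1] -> y \in `]0, 1] -> x <= y ->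
     Delta x / x ^+ 2 <= Delta y / y ^+ 2) /\
  cvg ((fun e : R => Delta e / e ^+ 2) @ 0^'+).
Proof.
have lip (x y : R) : x \in `]0, 1] -> y \in `]0, 1] ->
    `|Delta x - Delta y| <= 2 * `|x - y|.
  rewrite !in_itv/= => /andP[x0 x1] /andP[y0 y1].
  by apply: Delta_lip; rewrite ltW.
split=> //; split; last split.
- apply/subspace_continuousP => x x01; apply/cvgrPdist_le => e e0.
  have e20 : 0 < e / 2 by exact: divr_gt0.
  have xe : \forall t \near (x : R), `|(x : R) - t| <= e / 2.
    by apply: filterS (@nbhsx_ballx R R x _ e20) => t /ltW.
  near=> t.
  have t01 : `]0, 1]%classic t by near: t; exact: withinT.
  have : `|x - t| <= e / 2.
    by near: t; apply: cvg_within; exact: xe.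
  by have := lip x t x01 t01; lra.
- move=> x y; rewrite !in_itv/= => /andP[x0 _] /andP[_ y1] xy.
  exact: Delta_scale.
(* A monotone quotient bounded below, here by 0, has a right limit at 0. *)
apply: nondecreasing_at_right_is_cvgr; near=> b.
  have b1 : b <= 1 by near: b; exact: nbhs_right_le.
  move=> x y; rewrite !in_itv/= => /andP[x0 _] /andP[_ yb] xy.
  by apply: Delta_scale => //; exact: ltW (lt_le_trans yb b1).
have b1 : b <= 1 by near: b; exact: nbhs_right_le.
exists 0 => _ [x + <-]; rewrite /= in_itv/= => /andP[x0 xb].
by rewrite divr_ge0 ?sqr_ge0// Delta_ge0// (ltW x0) (ltW (lt_le_trans xb b1)).
Unshelve. all: by end_near. Qed.
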